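(* Let $g,h\colon\mathbb{H}\times\mathbb{H}\to\mathbb{H}$ be componentwise differentiable functions of two quaternionic variables $(u,v)$, and let $f=g+he_4\colon\mathbb{O}\to\mathbb{O}$, where $x=u+ve_4\in\mathbb{O}$. Then: (a) $\partial_xf=0$ if and only if \[ \begin{cases} \partial_ug=\overline{h}\,\partial_v,\\ h\,\partial_u=-\partial_v\overline{g}. \end{cases} \] (b) $f\partial_x=0$ if and only if \[ \begin{cases} g\,\partial_u=\partial_{\overline{v}}h,\\ h\,\partial_{\overline{u}}=-\partial_vg. \end{cases} \]
   Context: Let $\mathbb{H}$ be the quaternions with conjugation $a\mapsto\overline{a}$. The octonions $\mathbb{O}$ are $\mathbb{H}\oplus\mathbb{H}$ with the multiplication $(a,b)(c,d)=(ac-\overline{d}b,\ da+b\overline{c})$. With $a\in\mathbb{H}$ identified with $(a,0)$ and $e_4=(0,1)$, one has $(a,b)=a+be_4$. The real basis is $e_0=1$, $e_1=i$, $e_2=j$, $e_3=k$, $e_4$, $e_5=e_1e_4=(0,i)$, $e_6=e_2e_4=(0,j)$, $e_7=e_3e_4=(0,k)$. A point $x=\sum_{j=0}^7x_je_j$ is written $x=u+ve_4$ with $u=x_0+x_1e_1+x_2e_2+x_3e_3$ and $v=x_4+x_5e_1+x_6e_2+x_7e_3$ in $\mathbb{H}$. The octonionic Cauchy-Riemann operator $\partial_x=\sum_{i=0}^7e_i\partial_{x_i}$ acts on $f=\sum_jf_je_j$ ($f_j$ real-valued) from the left by $\partial_xf=\sum_{i,j}e_ie_j\,\partial_{x_i}f_j$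 and from the right by $f\partial_x=\sum_{i,j}e_je_i\,\partial_{x_i}f_j$. The quaternionic Cauchy-Riemann operators are $\partial_u=\partial_{x_0}+e_1\partial_{x_1}+e_2\partial_{x_2}+e_3\partial_{x_3}$, $\partial_v=\partial_{x_4}+e_1\partial_{x_5}+e_2\partial_{x_6}+e_3\partial_{x_7}$, with conjugates $\partial_{\overline{u}}$, $\partial_{\overline{v}}$ obtained by changing the signs of the $e_1,e_2,e_3$ terms. They act on $\mathbb{H}$-valued functions from the left ($\partial_ug$: basis elements multiply the function from the left) or from the right ($g\,\partial_u$: basis elements multiply from the right, the derivatives still acting on $g$). *)

(* Defs.v *)
From HB Require Import structures.
From mathcomp Require Import all_boot all_order all_algebra.
From mathcomp Require Import all_classical all_reals all_analysis.

Set Implicit Arguments.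
Unset Strict Implicit.
Unset Printing Implicit Defensive.

Import Order.TTheory GRing.Theory Num.Theory.
Import numFieldNormedType.Exports.

Local Open Scope ring_scope.

(* The quaternion a0 + a1 i + a2 j + a3 k is the row (a0, a1, a2, a3), so that
   quaternions inherit the normed-space structure of R^4. *)
Notation quat R := 'rV[R]_4.

Section Quaternions.
Context {R : realType}.
Implicit Types a b : quat R.

Definition qcoord (i : 'I_4) a : R := a 0 i.

Definition mkquat (a0 a1 a2 a3 : R) : quat R :=
  \row_(i < 4) [:: a0; a1; a2; a3]`_i.

Definition qbasis (i : 'I_4) : quat R := delta_mx 0 i.

Definition qone : quat R := qbasis 0.

Definition qconj a : quat R :=
  mkquat (qcoord 0 a) (- qcoord 1 a) (- qcoord 2 a) (- qcoord 3 a).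

Definition qmul a b : quat R :=
  let a0 := qcoord 0 a in let a1 := qcoord 1 a in
  let a2 := qcoord 2 a in let a3 := qcoord 3 a in
  let b0 := qcoord 0 b in let b1 := qcoord 1 b in
  let b2 := qcoord 2 b in let b3 := qcoord 3 b in
  mkquat (a0 * b0 - a1 * b1 - a2 * b2 - a3 * b3)
         (a0 * b1 + a1 * b0 + a2 * b3 - a3 * b2)
         (a0 * b2 - a1 * b3 + a2 * b0 + a3 * b1)
         (a0 * b3 + a1 * b2 - a2 * b1 + a3 * b0).

End Quaternions.

(* The pair (u, v) is the octonion u + v e4; its norm is the maximum of the
   norms of u and v, which defines the usual topology of R^8. *)
Notation oct R := (quat R * quat R)%type.

Section Octonions.
Context {R : realType}.
Implicit Types x y : oct R.

Definition omul x y : oct R :=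
  (qmul x.1 y.1 - qmul (qconj y.2) x.2, qmul y.2 x.1 + qmul x.2 (qconj y.1)).

Definition oct_of_quat (a : quat R) : oct R := (a, 0).

Definition e4 : oct R := (0, qone).

(* [fintype.split] sends j < 4 to [inl j] and j >= 4 to [inr (j - 4)]. *)
Definition obasis (j : 'I_8) : oct R :=
  match fintype.split (j : 'I_(4 + 4)) with
  | inl i => (qbasis i, 0)
  | inr i => (0, qbasis i)
  end.

Definition ocoord (j : 'I_8) x : R :=
  match fintype.split (j : 'I_(4 + 4)) with
  | inl i => qcoord i x.1
  | inr i => qcoord i x.2
  end.

End Octonions.

Section CauchyRiemann.
Context {R : realType}.
Implicit Types (f : oct R -> oct R) (g : oct R -> quat R) (x : oct R).

(* The directional derivative along [obasis i] is the partial derivative with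
   respect to x_i. *)
Definition oct_CR_left f x : oct R :=
  \sum_(i < 8) \sum_(j < 8)
    'D_(obasis i) (fun y => ocoord j (f y)) x *: omul (obasis i) (obasis j).

Definition oct_CR_right f x : oct R :=
  \sum_(i < 8) \sum_(j < 8)
    'D_(obasis i) (fun y => ocoord j (f y)) x *: omul (obasis j) (obasis i).

(* The operator sum_i c_i d/d(w_i), with quaternionic coefficients c_i and
   directions w_i in O, is encoded by i |-> (c_i, w_i). *)
Definition qdiffop := 'I_4 -> quat R * oct R.

Definition D_u : qdiffop := fun i => (qbasis i, (qbasis i, 0)).
Definition D_v : qdiffop := fun i => (qbasis i, (0, qbasis i)).
Definition D_ubar : qdiffop := fun i => (qconj (qbasis i), (qbasis i, 0)).
Definition D_vbar : qdiffop := fun i => (qconj (qbasis i), (0, qbasis i)).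

Definition act_left (P : qdiffop) g x : quat R :=
  \sum_(i < 4) qmul (P i).1 ('D_((P i).2) g x).

Definition act_right g (P : qdiffop) x : quat R :=
  \sum_(i < 4) qmul ('D_((P i).2) g x) (P i).1.

Definition componentwise_differentiable g : Prop :=
  forall (i : 'I_4) x, differentiable (fun y => qcoord i (g y)) x.

End CauchyRiemann.

(* Main.v *)
Require Import Defs.
From HB Require Import structures.
From mathcomp Require Import all_boot all_order all_algebra.
From mathcomp Require Import all_classical all_reals all_analysis.
From mathcomp Require Import ring.
Import GRing.Theory Num.Theory numFieldNormedType.Exports.
Local Open Scope ring_scope.

(** The octonionic product [(a, b)(c, d) = (ac - \bar d b, da + b \bar c)] turns
    the proposition into a formal computation.  Read the operator as the octonion
    [\partial_x = \partial_u + \partial_v e_4] and multiply it by [g + h e_4] with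
    this rule, keeping track of sides:
    [\partial_x f = (\partial_u g - \bar h \partial_v)
                  + (h \partial_u + \partial_v \bar g) e_4] and
    [f \partial_x = (g \partial_u - \partial_{\bar v} h)
                  + (\partial_v g + h \partial_{\bar u}) e_4].
    The two systems say that both quaternionic components vanish.

    The formal product is legitimate for two reasons.  The product is bilinear,
    so summing the coordinates of a derivative against the products of basis
    elements is multiplying a basis element by that derivative
    ([oct_CR_leftE], [oct_CR_rightE]).  Differentiation along a fixed direction
    acts coordinate by coordinate on maps with differentiable coordinates
    ([derive_quat]), so it commutes with the conjugation that the product
    introduces ([derive_qconj]). *)

(** * Linearity of the products *)

Section Linearity.
Context {R : realType}.
Implicit Types (a b : quat R) (x y : oct R).

Lemma qconj_is_linear : linear (@qconj R).
Proof.
move=> k a b; apply/rowP => i; rewrite !mxE /qcoord !mxE.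
by case: i => [[|[|[|[|//]]]] ?] /=; ring.
Qed.
HB.instance Definition _ :=
  GRing.isLinear.Build R (quat R) (quat R) _ _ qconj_is_linear.

Lemma qmul_is_linear a : linear (qmul a).
Proof.
move=> k b c; apply/rowP => i; rewrite !mxE /qcoord !mxE.
by case: i => [[|[|[|[|//]]]] ?] /=; ring.
Qed.
HB.instance Definition _ a :=
  GRing.isLinear.Build R (quat R) (quat R) _ _ (qmul_is_linear a).

Lemma qmulr_is_linear b : linear (qmul^~ b).
Proof.
move=> k a c; apply/rowP => i; rewrite !mxE /qcoord !mxE.
by case: i => [[|[|[|[|//]]]] ?] /=; ring.
Qed.

Lemma qmul0r a : qmul 0 a = 0.
Proof. by have := qmulr_is_linear a (-1) 0 0; rewrite !scaleN1r !addNr. Qed.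

Lemma qmulr0 a : qmul a 0 = 0. Proof. exact: linear0. Qed.

Lemma qmul1q a : qmul qone a = a.
Proof.
apply/rowP => i; rewrite !mxE /qcoord !mxE /=.
rewrite !(mul1r, mul0r, subr0, addr0, add0r).
by case: i => [[|[|[|[|//]]]] ?] /=; congr (a 0 _); apply: val_inj.
Qed.

Lemma qconj0 : qconj 0 = 0 :> quat R. Proof. exact: linear0. Qed.

Lemma omul_is_linear x : linear (omul x).
Proof.
move=> k [y1 y2] [z1 z2]; rewrite /omul; congr pair => /=.
  by rewrite !linearP (qmulr_is_linear x.2) scalerBr opprD addrACA.
by rewrite !linearP (qmulr_is_linear x.1) scalerDr addrACA.
Qed.

Lemma omulr_is_linear y : linear (omul^~ y).
Proof.
move=> k [x1 x2] [z1 z2]; rewrite /omul; congr pair => /=.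
  by rewrite linearP (qmulr_is_linear y.1) scalerBr opprD addrACA.
by rewrite linearP (qmulr_is_linear (qconj y.1)) scalerDr addrACA.
Qed.

End Linearity.

(** * The octonionic basis in quaternionic terms *)

Section OctonionicBasis.
Context {R : realType}.
Implicit Types (a b : quat R) (x y : oct R).

Lemma obasis_lshift (i : 'I_4) : obasis (lshift 4 i) = (qbasis i, 0) :> oct R.
Proof. by rewrite /obasis (unsplitK (inl i)). Qed.

Lemma obasis_rshift (i : 'I_4) : obasis (rshift 4 i) = (0, qbasis i) :> oct R.
Proof. by rewrite /obasis (unsplitK (inr i)). Qed.

Lemma ocoord_lshift (i : 'I_4) x : ocoord (lshift 4 i) x = qcoord i x.1.
Proof. by rewrite /ocoord (unsplitK (inl i)). Qed.

Lemma ocoord_rshift (i : 'I_4) x : ocoord (rshift 4 i) x = qcoord i x.2.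
Proof. by rewrite /ocoord (unsplitK (inr i)). Qed.

Lemma sum_oct (n : nat) (F : 'I_n -> oct R) :
  \sum_i F i = (\sum_i (F i).1, \sum_i (F i).2).
Proof. by elim/big_rec3: _ => // i ? ? [? ?] _ ->; case: (F i). Qed.

Lemma sum_obasis (F : oct R -> oct R) :
  \sum_(i < 8) F (obasis i) =
  (\sum_(i < 4) (F (qbasis i, 0)).1 + \sum_(i < 4) (F (0, qbasis i)).1,
   \sum_(i < 4) (F (qbasis i, 0)).2 + \sum_(i < 4) (F (0, qbasis i)).2).
Proof.
rewrite sum_oct !(@big_split_ord _ _ _ 4 4) /=.
by congr (_ + _, _ + _); apply: eq_bigr => i _;
  rewrite ?obasis_lshift ?obasis_rshift.
Qed.

Lemma oct_basis_expansion x : x = \sum_(j < 8) ocoord j x *: obasis j.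
Proof.
rewrite (@big_split_ord _ _ _ 4 4) /=.
under eq_bigr do rewrite ocoord_lshift obasis_lshift.
under [X in _ + X]eq_bigr do rewrite ocoord_rshift obasis_rshift.
rewrite !sum_oct /=.
case: x => a b /=; congr pair => /=.
  rewrite [X in _ + X]big1 ?addr0 => [|i _]; last by rewrite scaler0.
  exact: row_sum_delta.
rewrite [X in X + _]big1 ?add0r => [|i _]; last by rewrite scaler0.
exact: row_sum_delta.
Qed.

Lemma linear_oct_expansion (L : oct R -> oct R) x : linear L ->
  \sum_(j < 8) ocoord j x *: L (obasis j) = L x.
Proof.
move=> linL.
pose L' : {linear oct R -> oct R} :=
  HB.pack L (GRing.isLinear.Build R _ _ _ L linL).
transitivity (L' (\sum_(j < 8) ocoord j x *: obasis j)).
  by rewrite linear_sum; apply: eq_bigr => j _; rewrite linearZ.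
by rewrite -oct_basis_expansion.
Qed.

(** In the octonionic operator, a derivative along the first quaternionic
    variable has a coefficient of the form [a], and one along the second has a
    coefficient of the form [b e_4].  The four products with such coefficients
    decide the side and the conjugations of each term in the two systems. *)
Lemma omul_ql a y : omul (a, 0) y = (qmul a y.1, qmul y.2 a).
Proof. by rewrite /omul /= qmulr0 subr0 qmul0r addr0. Qed.

Lemma omul_qe4l b y :
  omul (0, b) y = (- qmul (qconj y.2) b, qmul b (qconj y.1)).
Proof. by rewrite /omul /= qmul0r sub0r qmulr0 add0r. Qed.

Lemma omul_qr a y : omul y (a, 0) = (qmul y.1 a, qmul y.2 (qconj a)).
Proof. by rewrite /omul /= qconj0 !qmul0r subr0 add0r. Qed.

Lemma omul_qe4r b y :
  omul y (0, b) = (- qmul (qconj b) y.2, qmul b y.1).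
Proof. by rewrite /omul /= qconj0 !qmulr0 sub0r addr0. Qed.

End OctonionicBasis.

(** * Derivatives of quaternion-valued functions *)

Section Derivatives.
Context {R : realType}.
Implicit Types (g h : oct R -> quat R) (x w : oct R).

(** A vector-valued map is derivable along [w] once all its coordinates are, so
    the componentwise hypothesis gives sense to the derivative of [g] itself. *)
Lemma derive_quat g x w : componentwise_differentiable g ->
  'D_w g x = \row_i 'D_w (fun y => qcoord i (g y)) x.
Proof.
move=> dg; rewrite derive_mx; last first.
  apply/derivable_mxP => j i; rewrite (ord1 j).
  exact/diff_derivable/dg.
by apply/rowP => i; rewrite !mxE.
Qed.

Lemma componentwise_differentiable_qconj g :
  componentwise_differentiable g ->
  componentwise_differentiable (fun y => qconj (g y)).
Proof.
move=> dg i x.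
case: i => [[|[|[|[|//]]]] lti]; rewrite /qcoord /qconj /mkquat /=;
  under eq_fun do rewrite mxE /=; try exact: differentiableN; exact: dg.
Qed.

Lemma derive_qconj g x w : componentwise_differentiable g ->
  'D_w (fun y => qconj (g y)) x = qconj ('D_w g x).
Proof.
move=> dg.
rewrite (derive_quat _ _ _ (componentwise_differentiable_qconj _ dg)).
rewrite (derive_quat _ _ _ dg) /qconj /mkquat.
apply/rowP => i; rewrite !mxE.
have dN (j : 'I_4) :
    'D_w (fun y => - qcoord j (g y)) x = - 'D_w (fun y => qcoord j (g y)) x.
  exact/deriveN/diff_derivable/dg.
case: i => [[|[|[|[|//]]]] lti]; rewrite /qcoord /= ?mxE -?dN;
  by under eq_fun do rewrite mxE /=.
Qed.

End Derivatives.

(** * The octonionic operators in quaternionic terms *)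

Section CauchyRiemannSystems.
Context {R : realType}.
Variables g h : oct R -> quat R.
Hypothesis dg : componentwise_differentiable g.
Hypothesis dh : componentwise_differentiable h.
Implicit Types x w : oct R.

Let f y : oct R := (g y, h y).

(** The right-hand side is written with the derivatives of [g] and [h] because
    the quaternionic operators differentiate these maps as wholes, whereas the
    octonionic ones differentiate real coordinates. *)
Lemma derive_ocoord (j : 'I_8) x w :
  'D_w (fun y => ocoord j (f y)) x = ocoord j ('D_w g x, 'D_w h x).
Proof.
by rewrite /ocoord; case: fintype.split => i /=;
  rewrite derive_quat // /qcoord mxE.
Qed.

(** Bilinearity collapses the inner sum over [j]: it is the expansion, in the
    basis, of the product with the derivative of [f] along [obasis i]. *)
Lemma oct_CR_leftE x :
  oct_CR_left f x =
  \sum_(i < 8) omul (obasis i) ('D_(obasis i) g x, 'D_(obasis i) h x).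
Proof.
apply: eq_bigr => i _.
under eq_bigr do rewrite derive_ocoord.
exact: linear_oct_expansion (omul_is_linear _).
Qed.

Lemma oct_CR_rightE x :
  oct_CR_right f x =
  \sum_(i < 8) omul ('D_(obasis i) g x, 'D_(obasis i) h x) (obasis i).
Proof.
apply: eq_bigr => i _.
under eq_bigr do rewrite derive_ocoord.
exact: linear_oct_expansion (omulr_is_linear _).
Qed.

Lemma oct_CR_left_components x :
  oct_CR_left f x =
  (act_left D_u g x - act_right (fun y => qconj (h y)) D_v x,
   act_right h D_u x + act_left D_v (fun y => qconj (g y)) x).
Proof.
rewrite oct_CR_leftE (sum_obasis (fun w => omul w ('D_w g x, 'D_w h x))).
congr pair.
  rewrite -sumrN; congr (_ + _); apply: eq_bigr => i _.
    by rewrite omul_ql.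
  by rewrite omul_qe4l derive_qconj.
congr (_ + _); apply: eq_bigr => i _.
  by rewrite omul_ql.
by rewrite omul_qe4l derive_qconj.
Qed.

Lemma oct_CR_right_components x :
  oct_CR_right f x =
  (act_right g D_u x - act_left D_vbar h x,
   act_right h D_ubar x + act_left D_v g x).
Proof.
rewrite oct_CR_rightE (sum_obasis (fun w => omul ('D_w g x, 'D_w h x) w)).
congr pair.
  rewrite -sumrN; congr (_ + _); apply: eq_bigr => i _.
    by rewrite omul_qr.
  by rewrite omul_qe4r.
congr (_ + _); apply: eq_bigr => i _.
  by rewrite omul_qr.
by rewrite omul_qe4r.
Qed.

End CauchyRiemannSystems.

Lemma quat_pair_eq0 {R : realType} (a b c d : quat R) :
  (a - b, c + d) = 0 :> oct R <-> a = b /\ c = - d.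
Proof.
split=> [[/eqP] | [-> ->]]; last by rewrite subrr addNr.
by rewrite subr_eq0 => /eqP-> /eqP; rewrite addr_eq0 => /eqP.
Qed.

Theorem proposition3p10 (R : realType) (g h : oct R -> quat R)
    (hg : componentwise_differentiable g)
    (hh : componentwise_differentiable h)
    (f : oct R -> oct R)
    (hf : forall x : oct R,
        f x = oct_of_quat (g x) + omul (oct_of_quat (h x)) e4) :
  ((forall x : oct R, oct_CR_left f x = 0) <->
   ((forall x : oct R,
       act_left D_u g x = act_right (fun y => qconj (h y)) D_v x) /\
    (forall x : oct R,
       act_right h D_u x = - act_left D_v (fun y => qconj (g y)) x)))
  /\
  ((forall x : oct R, oct_CR_right f x = 0) <->
   ((forall x : oct R, act_right g D_u x = act_left D_vbar h x) /\
    (forall x : oct R, act_right h D_ubar x = - act_left D_v g x))).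
Proof.
have {hf} -> : f = fun y => (g y, h y).
  apply/funext => x; rewrite hf omul_ql /= qmulr0 /oct_of_quat.
  (* [h e_4] is the pair [(0, h)]. *)
  by congr pair; rewrite /= ?addr0 // add0r qmul1q.
split; split.
- move=> CR0; split=> x; have := CR0 x;
    by rewrite oct_CR_left_components // => /quat_pair_eq0[].
- by case=> CR1 CR2 x; rewrite oct_CR_left_components //; apply/quat_pair_eq0.
- move=> CR0; split=> x; have := CR0 x;
    by rewrite oct_CR_right_components // => /quat_pair_eq0[].
- by case=> CR1 CR2 x; rewrite oct_CR_right_components //; apply/quat_pair_eq0.
Qed.
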